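(* Let $B$ be a skew-symmetrizable integer $n\times n$ matrix and let $\mathcal A\in\mathfrak A(B)$ be a cluster algebra satisfying one of the following two conditions: (i) $\mathcal A$ is of geometric type; (ii) $\mathcal A$ is arbitrary and $B$ is nondegenerate (i.e. $\det B\neq 0$). Then every seed in $\mathcal A$ is uniquely defined by its cluster. That is, if $\Sigma_1=(\mathbf x^{(1)},\mathbf y^{(1)},B^{(1)})$ and $\Sigma_2=(\mathbf x^{(2)},\mathbf y^{(2)},B^{(2)})$ are seeds of $\mathcal A$ (seeds mutation equivalent to the initial seed) such that for some permutation $\sigma\in S_n$ one has $x^{(2)}_i=x^{(1)}_{\sigma(i)}$ for all $i\in[1,n]$, then $y^{(2)}_i=y^{(1)}_{\sigma(i)}$ for all $i\in[1,n]$ and $b^{(2)}_{ij}=b^{(1)}_{\sigma(i)\sigma(j)}$ for all $i,j\in[1,n]$.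
   Context: A semifield $\mathcal P$ is a torsion-free multiplicative abelian group endowed with an additional operation $\oplus$ which is commutative, associative, and such that multiplication distributes over it. The ambient field $\mathcal F$ is the field of rational functions in $n$ independent variables with coefficients in the field of fractions of the integer group ring $\mathbb Z\mathcal P$. A square matrix $B$ is skew-symmetrizable if $DB$ is skew-symmetric for some diagonal matrix $D$ with positive diagonal entries. A seed is a triple $\Sigma=(\mathbf x,\mathbf y,B)$, where $\mathbf x=(x_1,\dots,x_n)$ (the cluster; its entries are the cluster variables) is a transcendence basis of $\mathcal F$ over the field of fractions of $\mathbb Z\mathcal P$, $\mathbf y=(y_1,\dots,y_n)$ (the coefficient tuple) is an $n$-tuple of elements of $\mathcal P$, and $B=(b_{ij})$ (the exchange matrix) is a skew-symmetrizable integer $n\times n$ matrix. The seed mutation in direction $k\in[1,n]$ takes $\Sigma$ to the adjacent seed $\Sigma'=(\mathbf x',\mathbf y',B')$ defined as follows. The cluster $\mathbf x'$ is obtained from $\mathbf x$ by replacing $x_k$ with $x_k'$ given by $$x_kx'_k=\frac{y_k}{y_k\oplus 1}\prod_{b_{ki}>0}x_i^{b_{ki}}+\frac{1}{y_k\oplus 1}\prod_{b_{ki}<0}x_i^{-b_{ki}}$$ (empty products equal $1$). The coefficients are $y'_k=y_k^{-1}$; for $j\ne k$, $y'_j=y_jy_k^{b_{jk}}(y_k\oplus1)^{-b_{jk}}$ if $b_{jk}>0$ and $y'_j=y_j(y_k\oplus1)^{-b_{jk}}$ if $b_{jk}\le 0$. The exchange matrix is $b'_{ij}=-b_{ij}$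 if $i=k$ or $j=k$, and $b'_{ij}=b_{ij}+\frac{|b_{ik}|b_{kj}+b_{ik}|b_{kj}|}{2}$ otherwise. (This exchange matrix is the transpose of the one used by Fomin and Zelevinsky.) Two seeds are mutation equivalent if one is obtained from the other by a sequence of seed mutations. The cluster algebra $\mathcal A(\Sigma)$ of rank $n$ associated with an initial seed $\Sigma$ is the $\mathbb Z\mathcal P$-subalgebra of $\mathcal F$ generated by all cluster variables in all seeds mutation equivalent to $\Sigma$; these seeds are the seeds of $\mathcal A(\Sigma)$. $\mathfrak A(B)$ denotes the family of all cluster algebras obtained by fixing the initial exchange matrix $B$ and varying the semifield $\mathcal P$, the initial coefficient tuple $\mathbf y$, and the initial cluster $\mathbf x$. $\mathcal A$ is of geometric type if $\mathcal P$ is a tropical semifield, i.e. the free multiplicative abelian group on finitely many generators $g_1,\dots,g_m$ with $\prod_{i=1}^m g_i^{a_i}\oplus\prod_{i=1}^m g_i^{b_i}=\prod_{i=1}^m g_i^{\min(a_i,b_i)}$. *)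

(* Defs.v *)
From HB Require Import structures.
From mathcomp Require Import all_boot all_order all_algebra.
From mathcomp Require Import perm finmap.
From mathcomp Require boolp classical_sets monalg.

Set Implicit Arguments.
Unset Strict Implicit.
Unset Printing Implicit Defensive.

Import Order.TTheory GRing.Theory Num.Theory.

Local Open Scope ring_scope.

HB.mixin Record Group_isSemifield P of monoid.Group P := {
  oplus : P -> P -> P;
  semifield_mulC : forall p q : P, (p * q = q * p)%g;
  semifield_torsion_free :
    forall (p : P) (m : nat), (0 < m)%N -> (p ^+ m = 1 -> p = 1)%g;
  oplusC : commutative oplus;
  oplusA : associative oplus;
  mulg_oplusr : forall p q r : P, (p * oplus q r)%g = oplus (p * q)%g (p * r)%g
}.

#[short(type="semifieldType")]
HB.structure Definition Semifield := { P of Group_isSemifield P & monoid.Group P }.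

Definition expgz (P : groupType) (p : P) (a : int) : P :=
  match a with Posz m => (p ^+ m)%g | Negz m => (p ^- m.+1)%g end.

(* [P] is free abelian on the generators [g 0, ..., g m.-1] (possibly none)
   and [oplus] takes the minimum of the exponents. *)
Definition tropical (P : semifieldType) : Prop :=
  exists (m : nat) (g : 'I_m -> P),
    let monomial (a : {ffun 'I_m -> int}) : P :=
      \big[*%g/1%g]_(i < m) expgz (g i) (a i) in
    bijective monomial
    /\ (forall a b : {ffun 'I_m -> int},
          oplus (monomial a) (monomial b) =
          monomial [ffun i => Order.min (a i) (b i)]).

(* A torsion-free abelian group carries a total order compatible with the
   multiplication, given here by the cone of elements above 1; comparing the
   largest elements of the supports then shows that its integral group ring is
   an integral domain. *)
Section PositiveCone.
Variable P : semifieldType.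
Implicit Types x y z : P.

Definition cone (C : P -> Prop) :=
  [/\ C 1%g, forall x y, C x -> C y -> C (x * y)%g
    & forall x, C x -> C (x^-1)%g -> x = 1%g].

Lemma cone_exp C x m : cone C -> C x -> C (x ^+ m)%g.
Proof.
by case=> C1 CM _ Cx; elim: m => [|m IH]; rewrite ?expg0 ?expgS //; apply: CM.
Qed.

Definition cone_adjoin (C : P -> Prop) x z :=
  exists c m, C c /\ z = (c * x ^+ m)%g.

Lemma cone_adjoin_pow C x :
  cone C -> ~ cone (cone_adjoin C x) ->
  exists2 m, (0 < m)%N & C (x ^- m)%g.
Proof.
move=> [C1 CM Cq] Ncone; apply: boolp.contrapT => Npow; apply: Ncone; split.
- by exists 1%g, 0%N; rewrite expg0 mulg1.
- move=> _ _ [c [m [Cc ->]]] [d [l [Cd ->]]]; exists (c * d)%g, (m + l)%N.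
  split; first exact: CM.
  by rewrite expgnDr !mulgA -(mulgA c) (semifield_mulC _ d) !mulgA.
move=> _ [c [m [Cc ->]]] [d [l [Cd E]]].
have Ecd : (x ^- (m + l) = c * d)%g.
  apply: (mulgI (x ^+ (m + l))%g).
  rewrite mulgV.
  have : ((c * x ^+ m) * (d * x ^+ l) = 1)%g by rewrite -E mulgV.
  rewrite mulgA -(mulgA c) (semifield_mulC _ d) mulgA -mulgA -expgnDr => E2.
  by rewrite semifield_mulC E2.
have ml0 : (m + l = 0)%N.
  case: (posnP (m + l)) => // ml_gt0.
  by case: Npow; exists (m + l)%N => //; rewrite Ecd; apply: CM.
move: ml0 Ecd => /eqP; rewrite addn_eq0 => /andP[/eqP-> /eqP->].
rewrite expg0 invg1 mulg1 => Ecd; apply: Cq => //.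
suff -> : (c^-1)%g = d by [].
by apply: (mulgI c); rewrite mulgV -Ecd.
Qed.

Lemma total_cone : exists2 C, cone C & forall x, C x \/ C (x^-1)%g.
Proof.
have [|C [coneC maxC]] := @classical_sets.Zorn_bigcup P (fun C => cone (fun x => C x \/ x = 1%g)).
  move=> F FP totF; split; first by right.
  - move=> x y [[X FX Xx]|->]; last by rewrite mul1g.
    move=> [[Y FY Yy]|->]; last by rewrite mulg1; left; exists X.
    have [XY|YX] := totF X Y FX FY.
      have [_ M _] := FP _ FY.
      by have [|->] := M x y (or_introl (XY _ Xx)) (or_introl Yy);
        [left; exists Y | right].
    have [_ M _] := FP _ FX.
    by have [|->] := M x y (or_introl Xx) (or_introl (YX _ Yy));
        [left; exists X | right].
  - move=> x [[X FX Xx]|-> //] [[Y FY Yy]|]; last first.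
      by move=> x1; rewrite -[x]invgK x1 invg1.
    have [XY|YX] := totF X Y FX FY.
      by have [_ _ Q] := FP _ FY; apply: Q; left => //; apply: XY.
    by have [_ _ Q] := FP _ FX; apply: Q; left => //; apply: YX.
pose D x := C x \/ x = 1%g.
exists D => // x; apply: boolp.contrapT => /boolp.not_orP[NDx NDVx].
have pow y : ~ D y -> exists2 m, (0 < m)%N & D (y ^- m)%g.
  move=> NDy; apply: cone_adjoin_pow => // coneE.
  apply: (maxC (cone_adjoin D y)).
    split.
      by move=> z Cz; exists z, 0%N; rewrite expg0 mulg1; split => //; left.
    move=> /(_ y) sub; apply: NDy; left; apply: sub.
    by exists 1%g, 1%N; rewrite mul1g expg1; split => //; right.
  suff -> : (fun z => cone_adjoin D y z \/ z = 1%g) = cone_adjoin D y by [].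
  apply: boolp.funext => z; apply: boolp.propext; split=> [[//|->]|]; last by left.
  by exists 1%g, 0%N; rewrite expg0 mulg1; split => //; right.
have [m m_gt0 Dm] := pow _ NDx; have [l l_gt0 Dl] := pow _ NDVx.
have x1 : (x ^+ (m * l) = 1)%g.
  have [_ _ Q] := coneC; apply: Q; last first.
    by rewrite expgnA -expVgn; apply: (cone_exp l coneC Dm).
  have : D ((x^-1) ^- l ^+ m)%g by apply: (cone_exp m coneC Dl).
  by rewrite (expVgn x l) invgK -expgnA mulnC.
apply: NDx; right; apply: semifield_torsion_free x1; by rewrite muln_gt0 m_gt0.
Qed.

End PositiveCone.

(* Finitely supported functions from [P] to [int], under convolution. *)
Definition group_ring (P : semifieldType) : Type := monalg.malg P int.

Section GroupRing.
Variable P : semifieldType.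
Import monalg.
Local Open Scope fset_scope.

HB.instance Definition _ := GRing.Zmodule.copy (group_ring P) (malg P int).

Implicit Types (g : group_ring P) (p q : P).

Definition gr_elt p : group_ring P := << p >>.

Definition gr_one : group_ring P := << 1%g >>.

Definition gr_mul g1 g2 : group_ring P :=
  \sum_(p <- msupp g1) \sum_(q <- msupp g2) << g1@_p * g2@_q *g (p * q)%g >>.

Lemma gr_mulw (d1 d2 : {fset P}) g1 g2 :
  msupp g1 `<=` d1 -> msupp g2 `<=` d2 ->
  gr_mul g1 g2 = \sum_(p <- d1) \sum_(q <- d2) << g1@_p * g2@_q *g (p * q)%g >>.
Proof.
move=> le_d1 le_d2; rewrite /gr_mul (big_fset_incl _ le_d1) /=.
  apply/eq_bigr=> k1 _; apply/big_fset_incl => // k _ /mcoeff_outdom ->.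
  by rewrite mulr0 monalgU0.
move=> k _ /mcoeff_outdom g1k.
by rewrite big1 => // k' _; rewrite g1k mul0r monalgU0.
Qed.

Lemma gr_mulC : commutative gr_mul.
Proof.
move=> g1 g2; rewrite /gr_mul exchange_big /=; apply: eq_bigr => q _.
by apply: eq_bigr => p _; rewrite mulrC semifield_mulC.
Qed.

Lemma gr_mul0g : left_zero 0 gr_mul.
Proof. by move=> g; rewrite /gr_mul msupp0 big_seq_fset0. Qed.

Lemma gr_mulUg c p g :
  gr_mul << c *g p >> g = \sum_(q <- msupp g) << c * g@_q *g (p * q)%g >>.
Proof.
rewrite (gr_mulw msuppU_le (fsubset_refl _)) big_seq_fset1.
by apply/eq_bigr => k' _; rewrite mcoeffUU.
Qed.

Lemma gr_mulUU c1 c2 p q :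
  gr_mul << c1 *g p >> << c2 *g q >> = << c1 * c2 *g (p * q)%g >>.
Proof. by rewrite (gr_mulw msuppU_le msuppU_le) !big_seq_fset1 !mcoeffUU. Qed.

Lemma gr_mul1g : left_id gr_one gr_mul.
Proof.
move=> g; rewrite gr_mulUg [RHS]monalgE.
by apply/eq_bigr=> q _; rewrite mul1r mul1g.
Qed.

Lemma gr_mulDl : left_distributive gr_mul +%R.
Proof.
move=> g1 g2 g.
rewrite [in RHS](gr_mulw (fsubsetUl _ (msupp g2)) (fsubset_refl _)).
rewrite [in RHS](gr_mulw (fsubsetUr (msupp g1) _) (fsubset_refl _)).
rewrite (gr_mulw (msuppD_le _ _) (fsubset_refl _)).
rewrite -big_split /=; apply/eq_bigr=> k1 _.
rewrite -big_split /=; apply/eq_bigr=> k2 _.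
by rewrite mcoeffD mulrDl monalgUD.
Qed.

Lemma gr_mulDr : right_distributive gr_mul +%R.
Proof. by move=> g1 g2 g; rewrite !(gr_mulC g1) gr_mulDl. Qed.

Lemma gr_mulE g1 g2 :
  gr_mul g1 g2 = \sum_(p <- msupp g1) gr_mul << g1@_p *g p >> g2.
Proof. by apply/eq_bigr=> k _; rewrite gr_mulUg. Qed.

Lemma gr_mulA : associative gr_mul.
Proof.
have sumL (I : Type) (r : seq I) F g :
    gr_mul (\sum_(i <- r) F i) g = \sum_(i <- r) gr_mul (F i) g.
  by rewrite (big_morph (gr_mul^~ g) (fun _ _ => gr_mulDl _ _ _) (gr_mul0g _)).
have sumR (I : Type) (r : seq I) F g :
    gr_mul g (\sum_(i <- r) F i) = \sum_(i <- r) gr_mul g (F i).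
  by rewrite gr_mulC sumL; apply: eq_bigr => i _; rewrite gr_mulC.
move=> g1 g2 g3.
rewrite [in LHS]gr_mulE [gr_mul g1 g2]gr_mulE sumL; apply: eq_bigr => p _.
rewrite [gr_mul g2 g3]gr_mulE [in RHS](monalgE g2) !sumR sumL.
apply: eq_bigr => q _.
rewrite [in RHS](monalgE g3) [in LHS](monalgE g3).
rewrite !(sumR _ _ (fun r => << g3@_r *g r >>)).
rewrite (sumR _ _ (fun r => gr_mul << g2@_q *g q >> << g3@_r *g r >>)).
by apply: eq_bigr => r _; rewrite !gr_mulUU mulrA mulgA.
Qed.

Lemma gr_one_neq0 : gr_one != 0.
Proof. by rewrite monalgU_eq0 oner_eq0. Qed.

HB.instance Definition _ := GRing.Zmodule_isComNzRing.Build (group_ring P)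
  gr_mulA gr_mulC gr_mul1g gr_mulDl gr_one_neq0.

Let max_supp (C : P -> Prop) (s : seq P) :
  cone C -> (forall x, C x \/ C (x^-1)%g) -> s != [::] ->
  exists2 u, u \in s & forall p, p \in s -> C (p^-1 * u)%g.
Proof.
move=> coneC tot; have [C1 CM _] := coneC.
elim: s => // a [|b s] IH _.
  by exists a => [|p]; rewrite inE // => /eqP->; rewrite mulVg.
have [//|u us max_u] := IH.
have [au|ua] := tot (a^-1 * u)%g.
  exists u; first by rewrite in_cons us orbT.
  by move=> p; rewrite in_cons => /predU1P[->|/max_u].
exists a; first by rewrite mem_head.
move=> p; rewrite in_cons => /predU1P[->|/max_u Cpu]; first by rewrite mulVg.
move: ua; rewrite invgM invgK => ua.
by rewrite -[a](mulVKg u) mulgA; apply: CM.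
Qed.

Lemma gr_mulf_eq0 g1 g2 : g1 * g2 = 0 -> (g1 == 0) || (g2 == 0).
Proof.
move=> g12; apply: contraT; rewrite negb_or => /andP[g1_neq0 g2_neq0].
have [C coneC tot] := total_cone P; have [_ CM Cq] := coneC.
have supp_neq0 (g : group_ring P) : g != 0 -> (msupp g : seq P) != [::].
  apply: contra_neq => g0; apply/malgP => k; rewrite mcoeff0 mcoeff_outdom //.
  by rewrite -[_ \in _]/(k \in (msupp g : seq P)) g0.
have [u u1 max_u] := max_supp coneC tot (supp_neq0 _ g1_neq0).
have [v v2 max_v] := max_supp coneC tot (supp_neq0 _ g2_neq0).
have uniq_max p q : p \in msupp g1 -> q \in msupp g2 -> (p * q = u * v)%g ->
    p = u /\ q = v.
  move=> /max_u Cp /max_v Cq' E.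
  have E2 : (p^-1 * u = (q^-1 * v)^-1)%g.
    rewrite invgM invgK; apply: (mulgI p); rewrite mulVKg.
    apply: (mulIg v); rewrite -E -!mulgA; congr (_ * _)%g.
    by rewrite (semifield_mulC q) mulKg.
  have q1 : (q^-1 * v = 1)%g by apply: Cq; rewrite // -E2.
  have p1 : (p^-1 * u = 1)%g by rewrite E2 q1 invg1.
  by split; [rewrite -[u](mulVKg p) p1 mulg1 | rewrite -[v](mulVKg q) q1 mulg1].
have : (g1 * g2 : malg P int)@_(u * v)%g = 0 by rewrite g12 mcoeff0.
rewrite -[g1 * g2]/(gr_mul g1 g2) /gr_mul raddf_sum /=.
rewrite (big_fsetD1 u) //= [X in (_ + X)%R]big1_fset ?addr0; last first.
  move=> p; rewrite in_fsetD1 => /andP[pu p1] _; rewrite raddf_sum /=.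
  rewrite big1_fset // => q q2 _; rewrite mcoeffU.
  by case: eqP => // /(uniq_max _ _ p1 q2)[/eqP]; rewrite (negbTE pu).
rewrite raddf_sum /= (big_fsetD1 v) //= [X in (_ + X)%R]big1_fset ?addr0; last first.
  move=> q; rewrite in_fsetD1 => /andP[qv q2] _; rewrite mcoeffU.
  by case: eqP => // /(uniq_max _ _ u1 q2)[_ /eqP]; rewrite (negbTE qv).
move=> /eqP; rewrite mcoeffUU mulf_eq0 !mcoeff_eq0.
by rewrite u1 v2.
Qed.

Definition gr_unit : pred (group_ring P) :=
  fun g => boolp.asbool (exists h, h * g == 1).

Definition gr_inv g : group_ring P :=
  if boolp.pselect (exists h, h * g == 1) is left gU then xchoose gU else g.

Lemma gr_mulVx : {in gr_unit, left_inverse 1 gr_inv *%R}.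
Proof.
move=> g /boolp.asboolP gU; rewrite /gr_inv.
by case: boolp.pselect => // gU'; apply/eqP/(xchooseP gU').
Qed.

Lemma gr_unitPl g h : h * g = 1 -> gr_unit g.
Proof. by move=> hg; apply/boolp.asboolP; exists h; apply/eqP. Qed.

Lemma gr_invr_out : {in [predC gr_unit], gr_inv =1 id}.
Proof.
move=> g /boolp.asboolP gU; rewrite /gr_inv.
by case: boolp.pselect => // /gU.
Qed.

HB.instance Definition _ := GRing.ComNzRing_hasMulInverse.Build (group_ring P)
  gr_mulVx gr_unitPl gr_invr_out.
HB.instance Definition _ :=
  GRing.ComUnitRing_isIntegral.Build (group_ring P) gr_mulf_eq0.

End GroupRing.

From mathcomp Require Import mpoly.

Definition skew_symmetrizable (n : nat) (B : 'M[int]_n) : Prop :=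
  exists2 d : 'rV[int]_n, (forall i, 0 < d 0 i) &
    (diag_mx d *m B)^T = - (diag_mx d *m B).

Section ClusterAlgebra.
Variables (P : semifieldType) (n : nat).

Definition coef_field : fieldType := {fraction group_ring P}.

Definition ambient : fieldType := {fraction {mpoly coef_field[n]}}.

Definition of_coef_field (c : coef_field) : ambient :=
  FracField.tofrac (c%:MP : {mpoly coef_field[n]}).

Definition of_semifield (p : P) : ambient :=
  of_coef_field (FracField.tofrac (gr_elt p)).

Definition evalp (x : 'I_n -> ambient) (q : {mpoly coef_field[n]}) : ambient :=
  mmap of_coef_field x q.

Definition algebraically_independent (x : 'I_n -> ambient) : Prop :=
  forall q : {mpoly coef_field[n]}, evalp x q = 0 -> q = 0.

Definition in_generated_subfield (x : 'I_n -> ambient) (f : ambient) : Prop :=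
  exists q r : {mpoly coef_field[n]},
    evalp x r != 0 /\ f = evalp x q / evalp x r.

Definition transcendence_basis (x : 'I_n -> ambient) : Prop :=
  algebraically_independent x
  /\ (forall f : ambient, exists q : {poly ambient},
        [/\ q != 0, forall i, in_generated_subfield x q`_i & root q f]).

Record seed := Seed {
  cluster : {ffun 'I_n -> ambient};
  coefficients : {ffun 'I_n -> P};
  exchange_matrix : 'M[int]_n
}.

Definition is_seed (S : seed) : Prop :=
  transcendence_basis (cluster S) /\ skew_symmetrizable (exchange_matrix S).

Definition mutate_cluster (k : 'I_n) (S : seed) : {ffun 'I_n -> ambient} :=
  let x := cluster S in
  let y := coefficients S in
  let B := exchange_matrix S in
  [ffun i => if i == k then
      (of_semifield (y k / oplus (y k) 1)%g
         * (\prod_(j < n | 0 < B k j) x j ^ (B k j))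
       + of_semifield ((oplus (y k) 1)^-1)%g
         * (\prod_(j < n | B k j < 0) x j ^ (- B k j))) / x k
    else x i].

Definition mutate_coefficients (k : 'I_n) (S : seed) : {ffun 'I_n -> P} :=
  let y := coefficients S in
  let B := exchange_matrix S in
  [ffun j => if j == k then ((y k)^-1)%g
    else if 0 < B j k then
      (y j * expgz (y k) (B j k) * expgz (oplus (y k) 1) (- B j k))%g
    else (y j * expgz (oplus (y k) 1) (- B j k))%g].

(* The division is exact: the numerator is 0 or +/- 2 * b_ik * b_kj. *)
Definition mutate_matrix (k : 'I_n) (B : 'M[int]_n) : 'M[int]_n :=
  \matrix_(i, j) if (i == k) || (j == k) then - B i j
    else B i j + ((`|B i k| * B k j + B i k * `|B k j|) %/ 2)%Z.

Definition mutate (k : 'I_n) (S : seed) : seed :=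
  Seed (mutate_cluster k S) (mutate_coefficients k S)
    (mutate_matrix k (exchange_matrix S)).

(* A single direction suffices, mutation in a given direction being an
   involution on seeds. *)
Definition mutation_equivalent (S S' : seed) : Prop :=
  exists ks : seq 'I_n, S' = foldl (fun T k => mutate k T) S ks.

End ClusterAlgebra.

(* Main.v *)
From HB Require Import structures.
Require Import Defs.
From mathcomp Require Import all_boot all_order all_algebra perm mpoly.
From mathcomp Require Import zify ring.
From mathcomp Require monalg.
Import Order.TTheory GRing.Theory Num.Theory.
Local Open Scope ring_scope.
Set Implicit Arguments.
Unset Strict Implicit.
Unset Printing Implicit Defensive.

(** The idea is to replace the ambient field by a totally ordered abelian
group.  Order the group [P * Z^n] of Laurent monomials [p * x0^a] in the initial
cluster [x0].  A ratio of two nonempty sums of such monomials then has a value: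
the largest monomial of its numerator over the largest monomial of its
denominator.  The value is well defined because the monomials are linearly
independent over the integers, it is multiplicative, and, since nothing cancels
in sums with positive coefficients, the value of a sum is the larger of the two
values ([has_value_unique], [has_valueM], [has_valueD]).  All cluster variables
are of this form, so that mutation acts on values: in the exchange relation one
of the two monomials wins, and the value of the new variable is read off from it
([has_value_mutate]).

Write [J] for the integer matrix whose rows are the exponent vectors of the
values of the cluster variables, and [yhat_i] for [y_i * prod_j x_j^(b_ij)].  A
mutation at [k] adds integer multiples of the value of [yhat_k] to those of the
other [yhat_i] and negates that of [yhat_k] ([yhat_mutate]).  Hence the values
of the [yhat_i] are obtained from the initial ones through a unimodular integer
matrix [C].  The factors by which a mutation multiplies [J] and [C] are dual to
each other with respect to the symmetrizer [D], whichever monomial wins, and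
so [J^T * D * C = D] in every seed ([dual_mutations], [tracked_mutations]).

Suppose that the clusters of two seeds agree up to a permutation [s].  Then the
rows of [J2] are those of [J1] permuted by [s], and duality yields
[d_(s i) * row (s i) C1 = d_i * row i C2].  The rows of the unimodular matrix
[C1] are primitive, so [d_i] divides [d_(s i)]; along a cycle of [s] this forces
equality.  Therefore [C2] is [C1] with permuted rows ([dual_row_perm]) and the
values of the [yhat_i] agree.  As [J1] is invertible, the value of [yhat_i]
determines both the [i]-th row of the exchange matrix and [y_i]
([yhat_injective]). *)

(** * The value group *)

(** A copy of [P] written additively, so that Laurent monomials become integer
combinations. *)
Definition additive_group (P : semifieldType) : Type := P.

HB.instance Definition _ (P : semifieldType) :=
  Choice.copy (additive_group P) P.

HB.instance Definition _ (P : semifieldType) :=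
  @GRing.isZmodule.Build (additive_group P) (1%g : P) (@monoid.inv P) (@monoid.mul P)
    (@mulgA P) (@semifield_mulC P) (@mul1g P) (@mulVg P).

Definition value_group (P : semifieldType) (n : nat) : zmodType :=
  (additive_group P * 'rV[int]_n)%type.

(** The elements [v] with [0 <= v] for a total order on [M] compatible with
the group law. *)
Definition total_positive_cone (M : zmodType) (nonneg : M -> Prop) : Prop :=
  [/\ nonneg 0, forall v w, nonneg v -> nonneg w -> nonneg (v + w),
      forall v, nonneg v -> nonneg (- v) -> v = 0
    & forall v, nonneg v \/ nonneg (- v)].

Definition lex_positive (n : nat) (v : 'rV[int]_n) : Prop :=
  exists2 i, 0 < v 0 i & forall j : 'I_n, (j < i)%N -> v 0 j = 0.

Lemma lex_positiveD n (v w : 'rV[int]_n) :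
  lex_positive v -> lex_positive w -> lex_positive (v + w).
Proof.
move=> [i vi vlt] [j wj wlt]; case: (ltngtP i j) => [ij|ji|/ord_inj ij].
- exists i => [|l li]; first by rewrite mxE (wlt i ij) addr0.
  by rewrite mxE vlt // wlt ?addr0 // (ltn_trans li).
- exists j => [|l lj]; first by rewrite mxE (vlt j ji) add0r.
  by rewrite mxE wlt // vlt ?addr0 // (ltn_trans lj).
subst j; exists i => [|l li]; first by rewrite mxE addr_gt0.
by rewrite mxE vlt // wlt ?addr0.
Qed.

Lemma lex_positiveN n (v : 'rV[int]_n) :
  lex_positive v -> ~ lex_positive (- v).
Proof.
by move=> v_gt0 /(lex_positiveD v_gt0)[i]; rewrite subrr mxE ltxx.
Qed.

Lemma lex_positive_total n (v : 'rV[int]_n) :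
  [\/ v = 0, lex_positive v | lex_positive (- v)].
Proof.
case: (pickP (fun i => v 0 i != 0)) => [i0 vi0|v0]; last first.
  by constructor 1; apply/rowP => i; rewrite mxE; apply/eqP/negbFE/v0.
case: (@arg_minnP _ i0 (fun i => v 0 i != 0) val vi0) => i vi imin.
have vlt (j : 'I_n) : (j < i)%N -> v 0 j = 0.
  by move=> ji; apply: contraTeq ji => /imin; rewrite -leqNgt.
case: (ltgtP 0 (v 0 i)) => [vi_gt0|vi_lt0|v0]; last by rewrite -v0 eqxx in vi.
  by constructor 2; exists i.
constructor 3; exists i => [|j /vlt]; rewrite mxE ?oppr_gt0 // => ->.
exact: oppr0.
Qed.

(** Lexicographic order: the exponent vector is compared first, then the
coefficient in [P], which is orderable because it is torsion-free. *)
Lemma value_group_order (P : semifieldType) n :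
  exists nonneg : value_group P n -> Prop, total_positive_cone nonneg.
Proof.
have [C [C1 CM CV] totC] := total_cone P.
exists (fun w => lex_positive w.2 \/ w.2 = 0 /\ C w.1); split.
- by right.
- move=> v w [v2|[v2 v1]] [w2|[w2 w1]] /=.
  + by left; apply: lex_positiveD.
  + by left; rewrite w2 addr0.
  + by left; rewrite v2 add0r.
  by right; split; [rewrite v2 w2 addr0 | apply: CM].
- move=> [v1 v2] /= [v_gt0|[-> Cv]] [vN|[vN CvN]].
  + by case: (lex_positiveN v_gt0).
  + have v20 : v2 = 0 by rewrite -[v2]opprK vN oppr0.
    by move: v_gt0; rewrite v20 => -[i]; rewrite mxE ltxx.
  + by move: vN; rewrite oppr0 => -[i]; rewrite mxE ltxx.
  by rewrite (CV v1).
move=> [v1 v2] /=; case: (lex_positive_total v2) => [->|v_gt0|v_lt0].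
- by case: (totC v1) => ?; [left | right]; right; rewrite ?oppr0.
- by left; left.
by right; left.
Qed.

(** * Values of subtraction-free elements *)

Lemma of_coef_field_zmod_morphism (P : semifieldType) n :
  zmod_morphism (@of_coef_field P n).
Proof. by move=> a b; rewrite /of_coef_field mpolyCB rmorphB. Qed.

Lemma of_coef_field_monoid_morphism (P : semifieldType) n :
  monoid_morphism (@of_coef_field P n).
Proof. by split=> [|a b]; rewrite /of_coef_field ?mpolyCM ?rmorphM ?rmorph1. Qed.

HB.instance Definition _ (P : semifieldType) n :=
  GRing.isZmodMorphism.Build (coef_field P) (ambient P n) (@of_coef_field P n)
    (@of_coef_field_zmod_morphism P n).
HB.instance Definition _ (P : semifieldType) n :=
  GRing.isMonoidMorphism.Build (coef_field P) (ambient P n)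
    (@of_coef_field P n) (@of_coef_field_monoid_morphism P n).

Section Value.
Variables (P : semifieldType) (n : nat) (x0 : 'I_n -> ambient P n).
Hypothesis x0_free : algebraically_independent x0.
Local Notation M := (value_group P n).
Variable nonneg : M -> Prop.
Hypothesis nonnegP : total_positive_cone nonneg.

Lemma of_semifieldM (p q : P) :
  @of_semifield P n (p * q)%g = of_semifield n p * of_semifield n q.
Proof.
have gr_eltM : gr_elt (p * q)%g = gr_elt p * gr_elt q.
  by rewrite [RHS]gr_mulUU mulr1.
by rewrite /of_semifield gr_eltM rmorphM /of_coef_field mpolyCM rmorphM.
Qed.

Lemma of_semifield1 : @of_semifield P n 1%g = 1.
Proof.
have -> : @of_semifield P n 1%g = FracField.tofrac (FracField.tofrac 1)%:MP.
  by [].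
by rewrite rmorph1.
Qed.

Lemma of_semifield_neq0 (p : P) : of_semifield n p != 0.
Proof.
apply: contra_eq_neq (@of_semifield1) => p0.
by rewrite -(mulgV p) of_semifieldM p0 mul0r eq_sym oner_eq0.
Qed.

Lemma x0_neq0 i : x0 i != 0.
Proof.
apply/eqP => x0i; have /x0_free/eqP : evalp x0 'X_i = 0.
  by rewrite /evalp mmapX mmap1U.
by rewrite -msupp_eq0 msuppX.
Qed.

Definition monomial (w : M) : ambient P n :=
  of_semifield n w.1 * \prod_i x0 i ^ w.2 0 i.

Lemma monomialD v w : monomial (v + w) = monomial v * monomial w.
Proof.
rewrite /monomial /= of_semifieldM mulrACA -big_split /=; congr (_ * _).
by apply: eq_bigr => i _; rewrite mxE expfzDr // x0_neq0.
Qed.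

Lemma monomial0 : monomial 0 = 1.
Proof.
by rewrite /monomial /= of_semifield1 mul1r big1 // => i _; rewrite mxE expr0z.
Qed.

Lemma monomial_neq0 w : monomial w != 0.
Proof.
rewrite mulf_neq0 ?of_semifield_neq0 //.
by apply/prodf_neq0 => i _; rewrite expfz_neq0 ?x0_neq0.
Qed.

Definition eval_sum (s : seq M) : ambient P n := \sum_(w <- s) monomial w.
Definition sums (s t : seq M) : seq M := [seq v + w | v <- s, w <- t].

Lemma eval_cat s t : eval_sum (s ++ t) = eval_sum s + eval_sum t.
Proof. by rewrite /eval_sum big_cat. Qed.

Lemma eval_sums s t : eval_sum (sums s t) = eval_sum s * eval_sum t.
Proof.
rewrite /eval_sum big_allpairs_dep /= mulr_suml; apply: eq_bigr => v _.
by rewrite mulr_sumr; apply: eq_bigr => w _; rewrite monomialD.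
Qed.

(** Clearing denominators turns both sums into polynomials in the algebraically
independent [x0]; the coefficient of a given monomial then counts its
occurrences, and a positive count cannot be compensated. *)
Lemma eval_sum_sub s t : eval_sum s = eval_sum t -> {subset s <= t}.
Proof.
move=> est w0 w0s.
(* A common denominator: every exponent of [x0] in either sum is at least [- N]. *)
pose N : nat := \sum_(w <- s ++ t) \sum_i `|w.2 0%R i|%N.
have Nle (w : M) (i : 'I_n) : w \in s ++ t -> 0 <= w.2 0 i + N%:Z.
  move=> wst; suff : (`|w.2 0%R i| <= N)%N by lia.
  rewrite /N (big_rem w) //= (bigD1 i) //=; lia.
pose m (w : M) : 'X_{1.. n} := [multinom absz (w.2 0 i + N%:Z)%R | i < n].
pose poly (r : seq M) : {mpoly coef_field P[n]} :=
  \sum_(w <- r) FracField.tofrac (gr_elt w.1) *: 'X_[m w].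
have polyE r : {subset r <= s ++ t} ->
    evalp x0 (poly r) = eval_sum r * \prod_i x0 i ^ N%:Z.
  move=> rst; rewrite /evalp /poly raddf_sum /= /eval_sum mulr_suml.
  rewrite big_seq [RHS]big_seq; apply: eq_bigr => w /rst wst.
  rewrite mmapZ mmapX -mulrA -big_split; congr (_ * _).
  rewrite /mmap1; apply: eq_bigr => i _.
  by rewrite -[RHS]expfzDr ?x0_neq0 // mnmE -[X in _ ^ X]gez0_abs // Nle.
have : poly s = poly t.
  apply/eqP; rewrite -subr_eq0; apply/eqP/x0_free.
  rewrite /evalp mmapB -/(evalp _ _) -/(evalp _ _) !polyE ?est ?subrr //.
    by move=> w wt; rewrite mem_cat wt orbT.
  by move=> w ws; rewrite mem_cat ws.
pose same (w : M) := ((w.1 : P) == w0.1) && (m w == m w0).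
have coefE r : (poly r)@_(m w0) = FracField.tofrac
    (\sum_(w <- r) gr_elt w.1 *+ (m w == m w0)).
  rewrite /poly raddf_sum raddf_sum; apply: eq_bigr => w _ /=.
  by rewrite mcoeffZ mcoeffX raddfMn /= mulr_natr.
have countE (r : seq M) : monalg.mcoeff (w0.1 : P)
    (\sum_(w <- r) gr_elt w.1 *+ (m w == m w0)) = (count same r)%:Z.
  elim: r => [|w r IH]; first by rewrite big_nil monalg.mcoeff0.
  rewrite big_cons monalg.mcoeffD IH monalg.mcoeffMn monalg.mcoeffU /= /same.
  by case: (_ == w0.1); case: (m w == m w0).
move/(congr1 (mcoeff (m w0))); rewrite !coefE => /eqP.
rewrite tofrac_eq => /eqP/(congr1 (monalg.mcoeff (w0.1 : P))).
rewrite !countE => -[count_st].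
have : has same t.
  by rewrite has_count -count_st -has_count; apply/hasP; exists w0; rewrite /same ?eqxx.
case/hasP => w wt /andP[/eqP w1 /eqP w2].
suff -> : w0 = w by [].
rewrite [w0]surjective_pairing [w]surjective_pairing w1; congr (_, _).
apply/rowP => i; move/(congr1 (fun k : 'X_{1.. n} => k i)): w2; rewrite !mnmE.
have := Nle w i; have := Nle w0 i; rewrite !mem_cat w0s wt orbT => /(_ isT) + /(_ isT).
lia.
Qed.

Lemma eval_sum_inj s t : eval_sum s = eval_sum t -> s =i t.
Proof. by move=> est w; apply/idP/idP; apply: eval_sum_sub. Qed.

Definition is_max (s : seq M) (u : M) : Prop :=
  u \in s /\ forall w, w \in s -> nonneg (u - w).

Lemma is_max_unique s t u v : s =i t -> is_max s u -> is_max t v -> u = v.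
Proof.
have [_ _ anti _] := nonnegP.
move=> st [us umax] [vt vmax]; apply/eqP; rewrite -subr_eq0; apply/eqP/anti.
  by apply: umax; rewrite st.
by rewrite opprB; apply: vmax; rewrite -st.
Qed.

Lemma is_max_sums s t u v :
  is_max s u -> is_max t v -> is_max (sums s t) (u + v).
Proof.
have [_ addP _ _] := nonnegP.
move=> [us umax] [vt vmax]; split; first exact: allpairs_f.
move=> _ /allpairsP[[w w'] [/umax uw /vmax vw' ->]].
by rewrite opprD addrACA; apply: addP.
Qed.

Lemma is_max_cat s t u v :
  is_max s u -> is_max t v -> nonneg (v - u) -> is_max (s ++ t) v.
Proof.
have [_ addP _ _] := nonnegP.
move=> [us umax] [vt vmax] vu; split; first by rewrite mem_cat vt orbT.
move=> w; rewrite mem_cat => /orP[/umax uw|/vmax//].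
by rewrite -[v](subrK u) -addrA; apply: addP.
Qed.

Lemma is_max1 u : is_max [:: u] u.
Proof.
have [nonneg0 _ _ _] := nonnegP.
by split=> [|w]; rewrite inE // => /eqP->; rewrite subrr.
Qed.

Lemma eval_sum_neq0 s u : is_max s u -> eval_sum s != 0.
Proof.
move=> [us _]; apply/eqP => s0.
have : eval_sum s = eval_sum [::] by rewrite s0 /eval_sum big_nil.
by move/eval_sum_inj/(_ u); rewrite us.
Qed.

(** A relation rather than a function on the ambient field: only the ratios of
sums of monomials are given a value. *)
Definition has_value (f : ambient P n) (w : M) : Prop :=
  exists s t u v,
    [/\ is_max s u, is_max t v, f * eval_sum t = eval_sum s & w = u - v].

Lemma has_value_unique f v w : has_value f v -> has_value f w -> v = w.
Proof.
move=> [s [t [a [b [sa tb fE ->]]]]] [s' [t' [a' [b' [sa' tb' fE' ->]]]]].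
have E : eval_sum (sums s t') = eval_sum (sums s' t).
  by rewrite !eval_sums -fE -fE' mulrAC.
apply/eqP; rewrite subr_eq addrAC -subr_eq opprK; apply/eqP.
exact: (is_max_unique (eval_sum_inj E) (is_max_sums sa tb') (is_max_sums sa' tb)).
Qed.

Lemma has_valueM f g v w :
  has_value f v -> has_value g w -> has_value (f * g) (v + w).
Proof.
move=> [s [t [a [b [sa tb fE ->]]]]] [s' [t' [a' [b' [sa' tb' gE ->]]]]].
exists (sums s s'), (sums t t'), (a + a'), (b + b').
split; try exact: is_max_sums.
  by rewrite !eval_sums mulrACA fE gE.
by rewrite opprD addrACA.
Qed.

Lemma has_valueV f v : has_value f v -> has_value f^-1 (- v).
Proof.
move=> [s [t [a [b [sa tb fE ->]]]]]; exists t, s, b, a; split => //.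
  have f0 : f != 0.
    by apply: contraTneq (eval_sum_neq0 sa) => f0; rewrite -fE f0 mul0r eqxx.
  by rewrite -fE mulKf.
by rewrite opprB.
Qed.

(** The sum of two fractions is formed over the product of their denominators;
as all coefficients are positive, the largest monomial of the numerator
survives. *)
Lemma has_valueD f g v w :
  has_value f v -> has_value g w -> nonneg (w - v) -> has_value (f + g) w.
Proof.
move=> [s [t [a [b [sa tb fE ->]]]]] [s' [t' [a' [b' [sa' tb' gE ->]]]]] vw.
exists (sums s t' ++ sums s' t), (sums t t'), (a' + b), (b + b').
split; last 1 first.
- by rewrite [b + b']addrC opprD addrACA subrr addr0.
- apply: is_max_cat (is_max_sums sa tb') (is_max_sums sa' tb) _.
  by move: vw; rewrite opprB addrACA opprD [- a - b']addrC.
- exact: is_max_sums.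
by rewrite eval_cat !eval_sums mulrDl mulrA fE mulrCA gE; congr (_ + _); rewrite mulrC.
Qed.

Lemma has_value_monomial w : has_value (monomial w) w.
Proof.
exists [:: w], [:: 0], w, 0; split; try exact: is_max1; last by rewrite subr0.
by rewrite /eval_sum !big_seq1 monomial0 mulr1.
Qed.

Definition of_P (p : P) : M := ((p : additive_group P), 0).

Lemma has_value_of_semifield p : has_value (of_semifield n p) (of_P p).
Proof.
have -> : of_semifield n p = monomial (of_P p).
  by rewrite /monomial big1 ?mulr1 // => i _; rewrite mxE.
exact: has_value_monomial.
Qed.

Lemma has_value_x0 i : has_value (x0 i) (0, delta_mx 0 i).
Proof.
have -> : x0 i = monomial (0, delta_mx 0 i).
  rewrite /monomial of_semifield1 mul1r (bigD1 i) //= mxE !eqxx.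
  by rewrite big1 ?mulr1 // => j /negbTE ji; rewrite mxE ji.
exact: has_value_monomial.
Qed.

Lemma has_valueX f w (a : int) : has_value f w -> has_value (f ^ a) (w *~ a).
Proof.
move=> fw; have natX m : has_value (f ^+ m) (w *+ m).
  elim: m => [|m IH]; last by rewrite exprS mulrS; apply: has_valueM.
  by rewrite expr0 -monomial0; apply: has_value_monomial.
case: a => m; first exact: natX.
by rewrite NegzE; apply: has_valueV; apply: natX.
Qed.

Lemma has_value_prod (I : Type) (r : seq I) (Q : pred I)
    (f : I -> ambient P n) w :
  (forall i, Q i -> has_value (f i) (w i)) ->
  has_value (\prod_(i <- r | Q i) f i) (\sum_(i <- r | Q i) w i).
Proof.
move=> fw; elim/big_rec2: _ => [|i v g Qi]; last exact/has_valueM/fw.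
by rewrite -monomial0; apply: has_value_monomial.
Qed.

End Value.

(** * Mutation of values *)

Definition pos_part (a : int) : int := if 0 < a then a else 0.

Lemma pos_partB a : pos_part a - pos_part (- a) = a.
Proof. by rewrite /pos_part; case: (ltrP 0 a); case: (ltrP 0 (- a)); lia. Qed.

(** A form of the correction term without division, in which the sign of
[B i k] selects one part of row [k]. *)
Lemma mutate_matrixE n k (B : 'M[int]_n) i j : i != k -> j != k ->
  mutate_matrix k B i j =
  B i j + B i k * (if 0 < B i k then pos_part (B k j) else pos_part (- B k j)).
Proof.
move=> /negbTE ik /negbTE jk; rewrite mxE ik jk /=; congr (_ + _).
set X := RHS; suff -> : `|B i k| * B k j + B i k * `|B k j| = X * 2.
  by rewrite mulzK.
rewrite /X /pos_part.
by case: (ltrP 0 (B i k)); case: (ltrP 0 (B k j)); case: (ltrP 0 (- B k j)); nia.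
Qed.

Definition skew_scaled n (d : 'rV[int]_n) (B : 'M[int]_n) : Prop :=
  forall i j, d 0 i * B i j = - (d 0 j * B j i).

Lemma skew_scaled_diag n (d : 'rV[int]_n) B i :
  (forall i, 0 < d 0 i) -> skew_scaled d B -> B i i = 0.
Proof. by move=> /(_ i) d_gt0 /(_ i i); nia. Qed.

Lemma skew_scaled_pos_part n (d : 'rV[int]_n) B i j :
  (forall i, 0 < d 0 i) -> skew_scaled d B ->
  d 0 i * pos_part (B i j) = d 0 j * pos_part (- B j i).
Proof.
move=> d_gt0 /(_ i j); have := d_gt0 i; have := d_gt0 j; rewrite /pos_part.
by case: (ltrP 0 (B i j)); case: (ltrP 0 (- B j i)); nia.
Qed.

(** Mutation preserves the symmetrizer: [B i k] and [B k i] have opposite signs,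
so the corrections at [(i, j)] and [(j, i)] select matching parts of row [k]. *)
Lemma skew_scaled_mutate n (d : 'rV[int]_n) B k :
  (forall i, 0 < d 0 i) -> skew_scaled d B -> skew_scaled d (mutate_matrix k B).
Proof.
move=> d_gt0 dB i j.
have [ik|ik] := boolP ((i == k) || (j == k)).
  by rewrite !mxE [(j == k) || _]orbC ik !mulrN dB.
move: ik; rewrite negb_or => /andP[ik jk].
rewrite !mutate_matrixE // !mulrDr dB opprD; congr (_ + _).
have sgn l : (0 < B l k) = (B k l < 0).
  by have h1 := d_gt0 l; have h2 := d_gt0 k; have h3 := dB l k; apply/idP/idP; nia.
rewrite !sgn !mulrA dB [d 0 j * _]dB !mulNr opprK -!mulrA -mulrN; congr (_ * _).
rewrite /pos_part; case: (ltgtP (B k i) 0); case: (ltgtP (B k j) 0);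
  case: (ltrP 0 (- B k j)); case: (ltrP 0 (- B k i)); nia.
Qed.

Section YhatMutation.
Variables (P : semifieldType) (n : nat).
Local Notation M := (value_group P n).
Implicit Types (S : seed P n) (u : 'I_n -> M).

(** The value of [y_i * prod_j x_j^(b_ij)]. *)
Definition yhat S u (i : 'I_n) : M :=
  of_P n (coefficients S i) + \sum_j u j *~ exchange_matrix S i j.

(** The value of the mutated cluster when the monomial of the exchange binomial
that dominates at [k] is the one with positive entries ([dir = true]) or the one
with negative entries ([dir = false]); the quotient of the two is [yhat k]. *)
Definition mutate_value (dir : bool) k S u (i : 'I_n) : M :=
  if i == k then
    (\sum_j u j *~ pos_part (- exchange_matrix S k j)
      + (if dir then yhat S u k else 0))
    - of_P n (oplus (coefficients S k) 1%g) - u k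
  else u i.

Lemma of_PM (p q : P) : of_P n (p * q)%g = of_P n p + of_P n q.
Proof. by rewrite /of_P; congr (_, _); rewrite /= addr0. Qed.

Lemma of_PV (p : P) : of_P n (p^-1)%g = - of_P n p.
Proof. by rewrite /of_P; congr (_, _); rewrite /= oppr0. Qed.

Lemma of_P_expgz (p : P) a : of_P n (expgz p a) = of_P n p *~ a.
Proof.
have natX m : of_P n (p ^+ m)%g = of_P n p *+ m.
  by elim: m => // m IH; rewrite expgS of_PM IH mulrS.
case: a => m /=; first exact: natX.
by rewrite of_PV natX.
Qed.

Lemma yhat_pos_part S u i :
  yhat S u i = of_P n (coefficients S i)
    + \sum_j u j *~ pos_part (exchange_matrix S i j)
    - \sum_j u j *~ pos_part (- exchange_matrix S i j).
Proof.
rewrite -addrA -sumrB; congr (_ + _); apply: eq_bigr => j _.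
by rewrite -mulrzBr pos_partB.
Qed.

Lemma yhat_mutate_dir dir k S u : exchange_matrix S k k = 0 ->
  yhat (mutate k S) (mutate_value dir k S u) k = - yhat S u k.
Proof.
move=> Bkk; rewrite /yhat /= ffunE eqxx of_PV opprD; congr (_ + _).
rewrite -sumrN; apply: eq_bigr => j _; rewrite mxE eqxx /mutate_value.
by case: eqP => [->|_]; rewrite ?Bkk ?mulr0z ?oppr0 // mulrNz.
Qed.

Fact telescope_terms (V : zmodType) (a z o c t v s r : V) :
  a + z - o + (- (c + t - o - v) + (s - v + (c + r - z))) = a + s + (r - t).
Proof.
rewrite !opprB !opprD !addrA.
rewrite [LHS](ACl (1*8*11*7*(2*12)*(3*5)*(4*9)*(6*10))) /=.
by rewrite !subrr !addNr !addr0.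
Qed.

(** The factor [oplus (y k) 1] enters [y j] and [x k] with opposite exponents, so
that it disappears from [yhat]; the exponent of [yhat k] that remains depends
only on which monomial dominates. *)
Lemma yhat_mutate dir k S u j : exchange_matrix S k k = 0 -> j != k ->
  yhat (mutate k S) (mutate_value dir k S u) j = yhat S u j
  + yhat S u k *~ (pos_part (exchange_matrix S j k)
                   - (if dir then exchange_matrix S j k else 0)).
Proof.
move=> Bkk jk; set B := exchange_matrix S in Bkk *; set b := B j k.
set O := of_P n (oplus (coefficients S k) 1%g).
set neg := \sum_i u i *~ pos_part (- B k i).
set pos := \sum_i u i *~ pos_part (B k i).
have ypos := yhat_pos_part S u k; rewrite -/B -/neg -/pos in ypos.
have coefE : of_P n (coefficients (mutate k S) j) = of_P n (coefficients S j)
    + (if 0 < b then of_P n (coefficients S k) *~ b else 0) - O *~ b.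
  rewrite /= ffunE (negbTE jk) -/B -/b; case: ifP => _;
    by rewrite !of_PM !of_P_expgz mulrNz ?addr0.
have clusterE : \sum_i mutate_value dir k S u i *~ mutate_matrix k B j i =
    - (mutate_value dir k S u k *~ b) + (\sum_i u i *~ B j i - u k *~ b
    + (if 0 < b then pos else neg) *~ b).
  rewrite (bigD1 k) //= mxE eqxx orbT mulrNz; congr (_ + _).
  have -> : (if 0 < b then pos else neg) *~ b = \sum_i u i *~
     (B j k * (if 0 < B j k then pos_part (B k i) else pos_part (- B k i))).
    rewrite /pos /neg -/b; case: ifP => _; rewrite mulrz_suml;
      by apply: eq_bigr => i _; rewrite -mulrzA mulrC.
  rewrite [X in _ = X - _ + _](bigD1 k) //= [X in _ = _ + X](bigD1 k) //= Bkk oppr0 if_same.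
  rewrite [pos_part 0]/(0 : int) mulr0 mulr0z add0r [u k *~ _ + _]addrC addrK -big_split /=.
  apply: eq_bigr => i ik; rewrite /mutate_value (negbTE ik).
  by rewrite mutate_matrixE // mulrzDr.
rewrite [LHS]/yhat coefE clusterE /mutate_value eqxx -/B -/b -/neg -/O.
rewrite [yhat S u j]/yhat -/B.
have splitE : (if 0 < b then pos else neg) *~ b = neg *~ b
    + yhat S u k *~ pos_part b - (if 0 < b then of_P n (coefficients S k) *~ b else 0).
  rewrite ypos /pos_part; case: ifP => _; last by rewrite mulr0z addr0 subr0.
  by rewrite -mulrzDl -mulrzBl [neg + _]addrC subrK addrAC subrr add0r.
rewrite splitE !mulrzBl mulrzDl.
rewrite [_ *~ (_ - _)]mulrzBr.
have -> : yhat S u k *~ (if dir then b else 0) = (if dir then yhat S u k else 0) *~ b.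
  by case: (dir); rewrite ?mulr0z ?mul0rz.
exact: telescope_terms.
Qed.
End YhatMutation.

Section ValueMutation.
Variables (P : semifieldType) (n : nat) (x0 : 'I_n -> ambient P n).
Hypothesis x0_free : algebraically_independent x0.
Local Notation M := (value_group P n).
Variable nonneg : M -> Prop.
Hypothesis nonnegP : total_positive_cone nonneg.
Local Notation has_value := (has_value x0 nonneg).

Lemma has_value_exchange_monomial (x : 'I_n -> ambient P n) (u : 'I_n -> M)
    (a : 'I_n -> int) :
  (forall i, has_value (x i) (u i)) ->
  has_value (\prod_(i < n | 0 < a i) x i ^ a i) (\sum_i u i *~ pos_part (a i)).
Proof.
move=> xu; have -> : \sum_i u i *~ pos_part (a i) = \sum_(i < n | 0 < a i) u i *~ a i.
  by rewrite [RHS]big_mkcond; apply: eq_bigr => i _; rewrite /pos_part; case: ifP.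
by apply: has_value_prod => // i _; apply: has_valueX.
Qed.

(** The order being total, [yhat k] lies on one side of the neutral element,
which decides the dominant monomial of the exchange relation. *)
Lemma has_value_mutate (S : seed P n) u k :
  (forall i, has_value (cluster S i) (u i)) ->
  exists dir, forall i,
    has_value (cluster (mutate k S) i) (mutate_value dir k S u i).
Proof.
move=> Su; have [_ _ _ tot] := nonnegP.
set B := exchange_matrix S; set y := coefficients S k.
set O := of_P n (oplus y 1%g).
set neg := \sum_i u i *~ pos_part (- B k i).
set pos := \sum_i u i *~ pos_part (B k i).
have ypos : yhat S u k = of_P n y + pos - neg by rewrite yhat_pos_part.
have val1 : has_value (of_semifield n (y / oplus y 1)%g
    * \prod_(j < n | 0 < B k j) cluster S j ^ B k j) (neg + yhat S u k - O).
  have -> : neg + yhat S u k - O = of_P n (y / oplus y 1)%g + pos.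
    by rewrite of_PM of_PV ypos [neg + _]addrC subrK addrAC.
  apply: has_valueM => //; first exact: has_value_of_semifield.
  exact: has_value_exchange_monomial.
have val2 : has_value (of_semifield n ((oplus y 1)^-1)%g
    * \prod_(j < n | B k j < 0) cluster S j ^ (- B k j)) (neg + 0 - O).
  rewrite addr0 addrC -of_PV; apply: has_valueM => //.
    exact: has_value_of_semifield.
  under eq_bigl do rewrite -oppr_gt0.
  exact: has_value_exchange_monomial.
suff [dir dirP] : exists dir : bool, has_value
    (of_semifield n (y / oplus y 1)%g
       * \prod_(j < n | 0 < B k j) cluster S j ^ B k j
     + of_semifield n ((oplus y 1)^-1)%g
       * \prod_(j < n | B k j < 0) cluster S j ^ (- B k j))
    (neg + (if dir then yhat S u k else 0) - O).
  exists dir => i; rewrite /= ffunE /mutate_value; case: eqP => // _.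
  by apply: has_valueM => //; apply: has_valueV.
have [y_ge0|y_le0] := tot (yhat S u k).
  exists true; rewrite addrC; apply: has_valueD val2 val1 _ => //.
  by rewrite addr0 opprB addrA addrNK addrAC subrr add0r.
exists false; apply: has_valueD val1 val2 _ => //.
by rewrite addr0 opprB addrA addrNK opprD addrA subrr add0r.
Qed.

End ValueMutation.

(** * Exponent matrices and their duality *)

(** Expanding the product leaves [diag_mx d] plus three multiples of
[e^T *m delta_mx 0 k], with coefficients [d k], [d k] and [e k * d k]. *)
Lemma dual_mutations n (d : 'rV[int]_n) k (e : 'rV[int]_n) (g : 'cV[int]_n) :
  e 0 k = -2 -> (forall j, d 0 j * g j 0 = d 0 k * e 0 j) ->
  (1%:M + delta_mx k 0 *m e)^T *m diag_mx d *m (1%:M + g *m delta_mx 0 k)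
    = diag_mx d.
Proof.
move=> ek dg.
have dk : (delta_mx 0 k : 'rV[int]_n) *m diag_mx d = d 0 k *: delta_mx 0 k.
  apply/rowP => j; rewrite mul_mx_diag !mxE eqxx /=.
  by case: eqP => [->|]; rewrite ?mul1r ?mulr1 ?mul0r ?mulr0.
have dgE : diag_mx d *m g = d 0 k *: e^T.
  by apply/colP => j; rewrite mul_diag_mx !mxE dg.
have kg : d 0 k *: ((delta_mx 0 k : 'rV[int]_n) *m g) = (d 0 k * -2)%:M.
  by apply/matrixP => i j; rewrite !ord1 -rowE !mxE dg ek mulr1n.
rewrite [(_ + _)^T]linearD /= trmx1 trmx_mul trmx_delta.
set dk0 := delta_mx 0 k in dk kg *; rewrite !(mulmxDl, mulmxDr) !mul1mx !mulmx1.
rewrite -[e^T *m dk0 *m diag_mx d]mulmxA dk -scalemxAr.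
rewrite [diag_mx d *m (g *m _)]mulmxA dgE -scalemxAl.
have -> : d 0 k *: (e^T *m dk0) *m (g *m dk0)
    = (d 0 k * -2) *: (e^T *m dk0).
  rewrite -scalemxAl -mulmxA [dk0 *m _]mulmxA scalemxAr [in LHS]scalemxAl kg.
  by rewrite mul_scalar_mx -scalemxAr.
rewrite -addrA -!scalerDl -[RHS]addr0; congr (_ + _).
have -> : d 0 k + (d 0 k + d 0 k * -2) = 0 by ring.
by rewrite scale0r.
Qed.

Lemma reflection_unitmx n k (g : 'cV[int]_n) :
  g k 0 = -2 -> 1%:M + g *m delta_mx 0 k \in unitmx.
Proof.
move=> gk; suff /mulmx1_unit[] : (1%:M + g *m delta_mx 0 k)
  *m (1%:M + g *m (delta_mx 0 k : 'rV_n)) = 1%:M by [].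
have kg : (delta_mx 0 k : 'rV[int]_n) *m g = (-2)%:M.
  by apply/matrixP => i j; rewrite !ord1 -rowE !mxE gk mulr1n.
rewrite mulmxDl !mulmxDr !mul1mx !mulmx1 -mulmxA [delta_mx 0 k *m _]mulmxA kg.
rewrite mul_scalar_mx -scalemxAr -[RHS]addr0 -!addrA; congr (_ + _).
by rewrite scaleNr addrA -mulr2n scaler_nat subrr.
Qed.

Section Tracking.
Variables (P : semifieldType) (n : nat).
Local Notation M := (value_group P n).
Implicit Types (S : seed P n) (u : 'I_n -> M).

Definition exponent_matrix u : 'M[int]_n := \matrix_(i, a) (u i).2 0 a.

(** A mutation at [k] multiplies the exponent matrix on the left by the identity
with this vector added to row [k]; the entry [-2] at [k] turns the diagonal
coefficient into [-1].  [col_reflection] does the same for the exponents of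
[yhat], with column [k]. *)
Definition row_reflection dir k (B : 'M[int]_n) : 'rV[int]_n :=
  \row_j (pos_part (- B k j) + (if dir then B k j else 0)
          - (if j == k then 2 else 0)).

Definition col_reflection dir k (B : 'M[int]_n) : 'cV[int]_n :=
  \col_j (pos_part (B j k) - (if dir then B j k else 0)
          - (if j == k then 2 else 0)).

Lemma snd_sum (F : 'I_n -> M) a : (\sum_i F i).2 0 a = \sum_i (F i).2 0 a.
Proof. by rewrite raddf_sum summxE. Qed.

Lemma snd_mulz (w : M) z a : (w *~ z).2 0 a = w.2 0 a * z.
Proof.
rewrite -[in RHS](intz z) mulrzr raddfMz.
by case: z => m; rewrite ?NegzE ?mulrNz ?mxE -?pmulrn mulmxnE.
Qed.

Lemma exponent_matrix_mutate dir k S u :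
  exchange_matrix S k k = 0 ->
  exponent_matrix (mutate_value dir k S u) =
  (1%:M + delta_mx k 0 *m row_reflection dir k (exchange_matrix S))
    *m exponent_matrix u.
Proof.
move=> Bkk; apply/matrixP => i a; rewrite mulmxDl mul1mx -mulmxA [in RHS]mxE.
rewrite [(_ *m (_ *m _)) i a]mxE big_ord1 !mxE /mutate_value.
case: (eqVneq i k) => [->|ik]; last by rewrite mul0r addr0.
have -> : (\sum_j u j *~ pos_part (- exchange_matrix S k j)
     + (if dir then yhat S u k else 0)
     - of_P n (oplus (coefficients S k) 1%g) - u k).2 0 a
   = \sum_j (pos_part (- exchange_matrix S k j)
       + (if dir then exchange_matrix S k j else 0)) * (u j).2 0 a - (u k).2 0 a.
  rewrite /= subr0 !mxE snd_sum; congr (_ - _).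
  under [RHS]eq_bigr do rewrite mulrDl.
  rewrite big_split; congr (_ + _).
    by apply: eq_bigr => j _; rewrite snd_mulz mulrC.
  case: dir; last by rewrite mxE big1 // => j _; rewrite mul0r.
  rewrite /= mxE mxE add0r snd_sum.
  by apply: eq_bigr => j _; rewrite snd_mulz mulrC.
rewrite eqxx mul1r.
under [in RHS]eq_bigr do rewrite !mxE mulrBl.
rewrite sumrB [X in _ = _ + (_ - X)](bigD1 k) //= eqxx
  [X in _ = _ + (_ - (_ + X))]big1; last first.
  by move=> j /negbTE ->; rewrite mul0r.
rewrite addr0 addrCA; congr (_ + _); ring.
Qed.

(** The hypothesis of [dual_mutations]: skew-symmetry relative to [d] turns the
negative part of row [k] into the positive part of column [k], and this holds
for both directions of domination. *)
Lemma row_col_reflection dir k (d : 'rV[int]_n) B j :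
  (forall i, 0 < d 0 i) -> skew_scaled d B ->
  d 0 j * col_reflection dir k B j 0 = d 0 k * row_reflection dir k B 0 j.
Proof.
move=> d_gt0 dB; rewrite !mxE !mulrBr mulrDr (skew_scaled_pos_part j k d_gt0 dB).
have -> : d 0 j * (if j == k then 2 else 0) = d 0 k * (if j == k then 2 else 0).
  by case: eqP => [->|]; rewrite ?mulr0.
by congr (_ + _ - _); case: dir; rewrite ?mulr0 ?oppr0 // dB opprK.
Qed.

Lemma reflection_diag dir k (B : 'M[int]_n) : B k k = 0 ->
  row_reflection dir k B 0 k = -2 /\ col_reflection dir k B k 0 = -2.
Proof. by move=> Bkk; rewrite !mxE Bkk eqxx !if_same. Qed.

Variable S0 : seed P n.
Hypothesis S0_free : algebraically_independent (cluster S0).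
Variable nonneg : M -> Prop.
Hypothesis nonnegP : total_positive_cone nonneg.

Definition initial_value (i : 'I_n) : M := (0, delta_mx 0 i).

(** [exponent_matrix u] and [C] are respectively the matrices [J] and [C] of the
duality [J^T * D * C = D]. *)
Definition tracked (d : 'rV[int]_n) S u (C : 'M[int]_n) : Prop :=
  [/\ skew_scaled d (exchange_matrix S),
      forall i, has_value (cluster S0) nonneg (cluster S i) (u i),
      forall i, yhat S u i = \sum_l yhat S0 initial_value l *~ C i l,
      (exponent_matrix u)^T *m diag_mx d *m C = diag_mx d
    & C \in unitmx].

Lemma tracked_initial d :
  skew_scaled d (exchange_matrix S0) -> tracked d S0 initial_value 1%:M.
Proof.
move=> dB; split => //; last exact: unitmx1.
- by move=> i; apply: has_value_x0.
- move=> i; rewrite (bigD1 i) //= mxE eqxx mulr1z big1 ?addr0 // => j ji.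
  by rewrite mxE eq_sym (negbTE ji) mulr0z.
have -> : exponent_matrix initial_value = 1%:M.
  by apply/matrixP => i a; rewrite !mxE eqxx eq_sym.
by rewrite trmx1 mul1mx mulmx1.
Qed.

Lemma tracked_mutate (d : 'rV[int]_n) S u C k : (forall i, 0 < d 0 i) ->
  tracked d S u C -> exists u' C', tracked d (mutate k S) u' C'.
Proof.
move=> d_gt0 [dB Su uC JC Cunit].
have [dir dirP] := has_value_mutate S0_free nonnegP k Su.
set B := exchange_matrix S in dB.
have Bkk : B k k = 0 by apply: skew_scaled_diag dB.
have [rk ck] := reflection_diag dir Bkk.
exists (mutate_value dir k S u),
  ((1%:M + col_reflection dir k B *m delta_mx 0 k) *m C).
split.
- exact: skew_scaled_mutate.
- exact: dirP.
- have CE i l : ((1%:M + col_reflection dir k B *m delta_mx 0 k) *m C) i l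
      = C i l + col_reflection dir k B i 0 * C k l.
    rewrite mulmxDl mul1mx -mulmxA -rowE mxE; congr (_ + _).
    by rewrite mxE big_ord1 [row _ _ _ _]mxE.
  move=> i; under [RHS]eq_bigr do rewrite CE mulrzDr [_ * C k _]mulrC mulrzA.
  rewrite big_split /= -mulrz_suml -!uC.
  case: (eqVneq i k) => [->|ik].
    by rewrite yhat_mutate_dir // ck -[X in _ = X + _]mulr1z -mulrzDr mulrN1z.
  by rewrite yhat_mutate // !mxE (negbTE ik) subr0.
- rewrite exponent_matrix_mutate // trmx_mul.
  rewrite -[RHS]JC -[_ *m diag_mx d]mulmxA -mulmxA -[in RHS]mulmxA.
  congr (_ *m _); rewrite mulmxA dual_mutations //.
  by move=> j; apply: row_col_reflection.
by rewrite unitmx_mul Cunit andbT reflection_unitmx.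
Qed.

Lemma tracked_mutations (d : 'rV[int]_n) S : (forall i, 0 < d 0 i) ->
  skew_scaled d (exchange_matrix S0) -> mutation_equivalent S0 S ->
  exists u C, tracked d S u C.
Proof.
move=> d_gt0 dB [ks ->]; elim/last_ind: ks => [|ks k [u [C uC]]].
  by exists initial_value, 1%:M; apply: tracked_initial.
by rewrite foldl_rcons; apply: tracked_mutate uC.
Qed.

End Tracking.

(** * Recovering the seed *)

(** The exponent vector of [yhat i] is row [i] of the exchange matrix multiplied
by the invertible exponent matrix; once the rows agree, the monomials in the
cluster cancel and the coefficients are left. *)
Lemma yhat_injective (P : semifieldType) n (S1 S2 : seed P n) u1 u2
    (s : 'S_n) i :
  exponent_matrix u1 \in unitmx ->
  (forall j, u2 j = u1 (s j)) -> yhat S2 u2 i = yhat S1 u1 (s i) ->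
  coefficients S2 i = coefficients S1 (s i)
  /\ (forall j, exchange_matrix S2 i j = exchange_matrix S1 (s i) (s j)).
Proof.
move=> J1unit u21; rewrite /yhat.
have -> : \sum_j u2 j *~ exchange_matrix S2 i j
    = \sum_j u1 j *~ exchange_matrix S2 i ((s^-1)%g j).
  rewrite [RHS](reindex_perm s) /=; apply: eq_bigr => j _.
  by rewrite u21 permK.
move=> y21.
pose r : 'rV[int]_n :=
  \row_j (exchange_matrix S2 i ((s^-1)%g j) - exchange_matrix S1 (s i) j).
have r0 : r = 0.
  rewrite -[r](mulmxK J1unit); suff -> : r *m exponent_matrix u1 = 0 by rewrite mul0mx.
  apply/rowP => a; move/(congr1 (fun w : value_group P n => w.2 0 a)): y21.
  rewrite /= !mxE !add0r !snd_sum => /eqP; rewrite -subr_eq0 -sumrB => /eqP E.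
  rewrite -[RHS]E; apply: eq_bigr => j _.
  by rewrite !snd_mulz !mxE -mulrBr mulrC.
have B21 j : exchange_matrix S2 i ((s^-1)%g j) = exchange_matrix S1 (s i) j.
  by apply/eqP; rewrite -subr_eq0; move/rowP/(_ j): r0; rewrite !mxE => /eqP.
split=> [|j]; last by rewrite -B21 permK.
move: y21; under eq_bigr do rewrite B21.
by move/addIr/(congr1 fst).
Qed.

(** The two functions have the same sum. *)
Lemma perm_le_eq (n : nat) (s : 'S_n) (d : 'I_n -> int) :
  (forall i, d i <= d (s i)) -> forall i, d (s i) = d i.
Proof.
move=> d_le i.
have /leif_sum[_ /esym] : forall i, true -> d i <= d (s i) ?= iff (d i == d (s i)).
  by move=> j _; split.
by rewrite [X in X == _](reindex_perm s) eqxx => /forallP/(_ i)/eqP.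
Qed.

(** Duality determines [C] from [J] up to the scaling by [d].  That the scaling is
invariant under [s] comes from integrality: the rows of the unimodular [C1] are
primitive, so [d i] divides [d (s i)]. *)
Lemma dual_row_perm n (d : 'rV[int]_n) (J1 J2 C1 C2 : 'M[int]_n) (s : 'S_n) :
  (forall i, 0 < d 0 i) -> C1 \in unitmx ->
  J1^T *m diag_mx d *m C1 = diag_mx d -> J2^T *m diag_mx d *m C2 = diag_mx d ->
  J2 = row_perm s J1 ->
  J1 \in unitmx /\ C2 = row_perm s C1.
Proof.
move=> d_gt0 C1unit JC1 JC2 J21.
have J1unit : J1 \in unitmx.
  have dD : \det (diag_mx d) != 0.
    by rewrite det_diag; apply/prodf_neq0 => i _; rewrite gt_eqF.
  move/(congr1 determinant)/eqP: JC1; rewrite !det_mulmx det_tr mulrAC.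
  rewrite -subr_eq0 -{2}[\det (diag_mx d)]mul1r -mulrBl mulf_eq0 (negbTE dD) orbF.
  rewrite subr_eq0 => /eqP J1C1.
  by rewrite unitmxE; apply/unitrPr; exists (\det C1).
split=> //.
have DC : row_perm s (diag_mx d *m C1) = diag_mx d *m C2.
  have J1T : J1^T \in unitmx by rewrite unitmx_tr.
  have E : J1^T *m (diag_mx d *m C1)
      = J1^T *m row_perm (s^-1)%g (diag_mx d *m C2).
    rewrite mulmxA JC1 -[LHS]JC2 -mulmxA J21 tr_row_perm col_permE row_permE.
    by rewrite [RHS]mulmxA.
  by rewrite -[diag_mx d *m C1](mulKmx J1T) E mulKmx // -row_permM mulgV row_perm1.
have DCe i b : d 0 (s i) * C1 (s i) b = d 0 i * C2 i b.
  by move/matrixP/(_ i b): DC; rewrite mxE !mul_diag_mx !mxE.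
have d_s : forall i, d 0 (s i) = d 0 i.
  apply: (@perm_le_eq _ s (d 0)) => i.
  (* Row [s i] of [C1 *m invmx C1] is a Bezout relation for row [s i] of [C1]. *)
  have : d 0 (s i) = d 0 i * \sum_b C2 i b * invmx C1 b (s i).
    rewrite mulr_sumr; under eq_bigr do rewrite mulrA -DCe -mulrA.
    rewrite -mulr_sumr; move/matrixP/(_ (s i) (s i)): (mulmxV C1unit).
    by rewrite !mxE eqxx => ->; rewrite mulr1.
  set z := \sum_b _ => ds; have z_gt0 : 0 < z.
    by rewrite -(pmulr_rgt0 _ (d_gt0 i)) -ds.
  by rewrite ds ler_peMr // ltW.
apply/matrixP => i b; rewrite mxE.
by apply: (@mulfI _ (d 0 i)); rewrite ?gt_eqF // -DCe d_s.
Qed.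

Theorem theorem4 (P : semifieldType) (n : nat) (B : 'M[int]_n)
    (S0 : seed P n) :
  skew_symmetrizable B ->
  is_seed S0 -> exchange_matrix S0 = B ->
  (tropical P \/ \det B != 0) ->
  forall S1 S2 : seed P n,
    mutation_equivalent S0 S1 -> mutation_equivalent S0 S2 ->
  forall s : 'S_n,
    (forall i : 'I_n, cluster S2 i = cluster S1 (s i)) ->
    (forall i : 'I_n, coefficients S2 i = coefficients S1 (s i))
    /\ (forall i j : 'I_n,
          exchange_matrix S2 i j = exchange_matrix S1 (s i) (s j)).
Proof.
move=> [d d_gt0 dB] [[S0_free _] _] S0B _ S1 S2 S01 S02 s x21.
have [nonneg nonnegP] := value_group_order P n.
have skew : skew_scaled d (exchange_matrix S0).
  move=> i j; rewrite S0B; move/matrixP/(_ j i): dB.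
  by rewrite mxE [RHS]mxE !mul_diag_mx !mxE.
have [u1 [C1 [_ v1 yC1 JC1 C1unit]]] := tracked_mutations S0_free nonnegP d_gt0 skew S01.
have [u2 [C2 [_ v2 yC2 JC2 _]]] := tracked_mutations S0_free nonnegP d_gt0 skew S02.
have u21 i : u2 i = u1 (s i).
  apply: (has_value_unique S0_free nonnegP) (v2 i) _.
  by rewrite x21.
have [|J1unit C21] := dual_row_perm d_gt0 C1unit JC1 JC2 (s := s).
  by apply/matrixP => i a; rewrite !mxE u21.
have yhat21 i : yhat S2 u2 i = yhat S1 u1 (s i).
  by rewrite yC1 yC2 C21; apply: eq_bigr => l _; rewrite mxE.
by split=> i; have [] := yhat_injective J1unit u21 (yhat21 i).
Qed.
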